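(* Let $n\ge 2$ and let $K_n$ denote the complete graph with $n$ vertices. Then $C_{K_n}=n$.
   Context: For a metric space $(X,d)$, write $B(x,r)=\{y\in X: d(x,y)<r\}$ for $x\in X$, $r>0$. All measures $\mu$ on $X$ considered are Borel regular and non-trivial in the sense that $0<\mu(B(x,r))<\infty$ for every $x\in X$ and $r>0$. Such a $\mu$ is called doubling if there is a constant $C\ge 1$ with $\mu(B(x,2r))\le C\mu(B(x,r))$ for all $x\in X$, $r>0$; in that case $C_\mu=\sup_{x\in X,\,r>0}\frac{\mu(B(x,2r))}{\mu(B(x,r))}$. The least doubling constant of $(X,d)$ is $C_{(X,d)}=\inf\{C_\mu:\mu\text{ doubling measure on }(X,d)\}$, with $C_{(X,d)}=\infty$ if no doubling measure exists on $(X,d)$. For a simple connected graph $G$, $C_G$ denotes $C_{(V(G),d)}$, where $V(G)$ is the vertex set and $d$ is the shortest path distance (each edge has length 1). *)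

(* Defs.v *)
From HB Require Import structures.
From mathcomp Require Import all_boot all_order all_algebra.
From mathcomp Require Import boolp classical_sets reals ereal topology measure.

Set Implicit Arguments.
Unset Strict Implicit.
Unset Printing Implicit Defensive.

Import Order.TTheory GRing.Theory Num.Theory.

Local Open Scope classical_set_scope.
Local Open Scope ring_scope.

Section doubling.
Context {R : realType} {X : metricType R}.

Definition borel : set_system X := <<s @open X >>.

(* As usual for Borel regular measures on metric spaces, a measure is defined
   on all subsets, i.e. it is an outer measure. *)
Definition borel_regular (mu : {outer_measure set X -> \bar R}) : Prop :=
  borel `<=` mu.-caratheodory /\
  forall A : set X, exists B : set X, [/\ borel B, A `<=` B & mu B = mu A].

(* [ball x r] is the open ball [[set y | mdist x y < r]]: see [ballEmdist]. *)
Definition nontrivial_measure (mu : {outer_measure set X -> \bar R}) : Prop :=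
  forall (x : X) (r : R), 0 < r ->
    (0 < mu (ball x r))%E /\ (mu (ball x r) < +oo)%E.

Definition doubling (mu : {outer_measure set X -> \bar R}) : Prop :=
  exists C : R, 1 <= C /\ forall (x : X) (r : R), 0 < r ->
    (mu (ball x (2 * r)) <= C%:E * mu (ball x r))%E.

Definition doubling_measure (mu : {outer_measure set X -> \bar R}) : Prop :=
  [/\ borel_regular mu, nontrivial_measure mu & doubling mu].

Definition doubling_const (mu : {outer_measure set X -> \bar R}) : \bar R :=
  ereal_sup [set c | exists (x : X) (r : R),
    0 < r /\ c = (mu (ball x (2 * r)) / mu (ball x r))%E].

End doubling.

(* This is [+oo], the infimum of the empty set, when [X] carries no doubling
   measure. *)
Definition least_doubling_const (R : realType) (X : metricType R) : \bar R :=
  ereal_inf [set doubling_const mu |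
             mu in [set mu : {outer_measure set X -> \bar R} |
                    doubling_measure mu]].

Record connected_graph := ConnectedGraph {
  vertex : choiceType;
  adj : rel vertex;
  adj_sym : symmetric adj;
  adj_irr : irreflexive adj;
  adj_connected : forall x y, exists p, path adj x p /\ last x p = y
}.

Section graph_distance.
Variable G : connected_graph.
Implicit Types x y z : vertex G.

Definition walk_of_length x y (n : nat) : Prop :=
  exists p, [/\ path (@adj G) x p, last x p = y & size p = n].

Lemma walk_exists x y : exists n, `[< walk_of_length x y n >].
Proof.
by have [p [xp py]] := adj_connected x y; exists (size p); apply/asboolP; exists p.
Qed.

Definition gdist x y : nat := ex_minn (walk_exists x y).

Lemma gdist_walk x y : walk_of_length x y (gdist x y).
Proof. by rewrite /gdist; case: ex_minnP => n /asboolP. Qed.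

Lemma gdist_le x y n : walk_of_length x y n -> (gdist x y <= n)%N.
Proof. by rewrite /gdist; case: ex_minnP => m _ + xy; apply; apply/asboolP. Qed.

Lemma gdistxx x : gdist x x = 0%N.
Proof. by apply/eqP; rewrite -leqn0; apply: gdist_le; exists [::]. Qed.

Lemma gdist_eq0 x y : gdist x y = 0%N -> x = y.
Proof.
move=> xy; have [p [_ py]] := gdist_walk x y.
by rewrite xy => /size0nil p0; rewrite p0 in py.
Qed.

Lemma walk_sym x y n : walk_of_length x y n -> walk_of_length y x n.
Proof.
case=> p [xp py <-]; exists (rev (belast x p)); split.
- by rewrite -py rev_path (eq_path (e' := @adj G))// => u v; exact: adj_sym.
- by case: p xp py => [|a p] //= _ <-; rewrite rev_cons last_rcons.
- by rewrite size_rev size_belast.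
Qed.

Lemma gdist_sym x y : gdist x y = gdist y x.
Proof.
by apply/eqP; rewrite eqn_leq; apply/andP; split;
  apply/gdist_le/walk_sym/gdist_walk.
Qed.

Lemma gdist_triangle y x z : (gdist x z <= gdist x y + gdist y z)%N.
Proof.
have [p [xp py <-]] := gdist_walk x y; have [q [yq qz <-]] := gdist_walk y z.
apply: gdist_le; exists (p ++ q).
by rewrite cat_path last_cat xp py yq qz size_cat.
Qed.

End graph_distance.

Definition graph_space (R : realType) (G : connected_graph) : Type := vertex G.

Section graph_metric.
Variables (R : realType) (G : connected_graph).

HB.instance Definition _ := Choice.on (graph_space R G).

Let dist (x y : graph_space R G) : R := (@gdist G x y)%:R.

Let distxx x : dist x x = 0.
Proof. by rewrite /dist gdistxx. Qed.

Let dist_positivity x y : dist x y = 0 -> x = y.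
Proof. by move=> /eqP; rewrite pnatr_eq0 => /eqP/gdist_eq0. Qed.

Let dist_sym x y : dist x y = dist y x.
Proof. by rewrite /dist gdist_sym. Qed.

Let dist_triangle y x z : dist x z <= dist x y + dist y z.
Proof. by rewrite /dist -natrD ler_nat gdist_triangle. Qed.

HB.instance Definition _ := isMetric.Build R (graph_space R G)
  distxx dist_positivity dist_sym dist_triangle.

End graph_metric.

Lemma mdist_graphE (R : realType) (G : connected_graph)
  (x y : graph_space R G) : mdist x y = (@gdist G x y)%:R.
Proof. by []. Qed.

Definition graph_doubling_const (R : realType) (G : connected_graph) : \bar R :=
  least_doubling_const (graph_space R G).

Section complete_graph.
Variable n : nat.

Definition complete_adj : rel 'I_n := fun x y => x != y.

Lemma complete_adj_sym : symmetric complete_adj.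
Proof. by move=> x y; rewrite /complete_adj eq_sym. Qed.

Lemma complete_adj_irr : irreflexive complete_adj.
Proof. by move=> x; rewrite /complete_adj eqxx. Qed.

Lemma complete_adj_connected (x y : 'I_n) :
  exists p, path complete_adj x p /\ last x p = y.
Proof.
have [->|xy] := eqVneq x y; first by exists [::].
by exists [:: y]; rewrite /= /complete_adj xy.
Qed.

Definition complete_graph : connected_graph :=
  ConnectedGraph complete_adj_sym complete_adj_irr complete_adj_connected.

End complete_graph.

(* Main.v *)
Require Import Defs.
From mathcomp Require Import all_boot all_order all_algebra.
From mathcomp Require Import reals ereal.
From HB Require Import structures.
From mathcomp Require Import classical_sets topology numfun.
From mathcomp Require Import sequences measure.

(** In [K_n] the only balls are the singletons (radius at most 1) and the whole
    space. A vertex [x] of least mass satisfies [n * mu {x} <= mu X], so the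
    ratio [mu (B(x, 2)) / mu (B(x, 1))] is at least [n]; for the counting
    measure no ratio exceeds [n]. *)

Import Order.TTheory GRing.Theory Num.Theory.

Local Open Scope classical_set_scope.
Local Open Scope ring_scope.

(** An outer measure alone is only subadditive, which is the wrong direction here. Carathéodory
    measurability of [[set x]] cuts [x :: s] exactly into its head and the rest, and uniqueness
    keeps [s] inside the rest. *)
Lemma sum_caratheodory_set1_le (R : realType) (T : eqType)
    (mu : {outer_measure set T -> \bar R}) (s : seq T) :
  (forall x, mu.-caratheodory [set x]) -> uniq s ->
  (\sum_(x <- s) mu [set x] <= mu [set` s])%E.
Proof.
move=> mu1; elim: s => [|x s ih] /= => [_|/andP[xs us]].
  by rewrite big_nil outer_measure_ge0.
rewrite big_cons (mu1 x [set` x :: s]); apply: leeD.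
  by apply: le_outer_measure => y /= ->; split => //=; rewrite mem_head.
apply: (le_trans (ih us)); apply: le_outer_measure => y /= ys; split => /=.
  by rewrite inE ys orbT.
by move=> yx; rewrite -yx ys in xs.
Qed.

Section counting_outer_measure.
Context {R : realType} {T : finType}.

(** Counting measure, written as a sum of indicators so that each axiom reduces to a check at a
    single point. *)
Definition counting_outer (A : set T) : \bar R :=
  (\sum_(i : T) (\1_A i)%:E)%E.

Lemma indicE_ge0 (A : set T) i : (0 <= (\1_A i : R)%:E)%E.
Proof. by rewrite lee_fin indicE ler0n. Qed.

Let counting_outer0 : counting_outer set0 = 0%E.
Proof. by rewrite /counting_outer big1// => i _; rewrite indic0. Qed.

Let counting_outer_ge0 A : (0 <= counting_outer A)%E.
Proof. by apply: sume_ge0 => i _; exact: indicE_ge0. Qed.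

Let counting_outer_le :
  {homo counting_outer : A B / A `<=` B >-> (A <= B)%E}.
Proof.
move=> A B AB; apply: lee_sum => i _; rewrite lee_fin !indicE ler_nat.
by case: (boolP (i \in A)) => // /set_mem/AB/mem_set ->.
Qed.

Let counting_outer_sigma_subadditive : sigma_subadditive counting_outer.
Proof.
(* Exchanging the series with the finite sum leaves one point [i]: if [i] lies in some [F k], the
   [k]-th term alone contributes 1. *)
move=> F; rewrite /counting_outer nneseries_sum; last first.
  by move=> i k _; exact: indicE_ge0.
apply: lee_sum => i _; rewrite indicE.
have [/set_mem[k _ Fki]|_] := boolP (i \in _); last first.
  by apply: nneseries_ge0 => k _ _; exact: indicE_ge0.
rewrite (@nneseriesD1 _ _ k)//.
rewrite [X in (X%:E + _)%E]indicE (mem_set Fki); apply: leeDl.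
by apply: nneseries_ge0 => j _ _; exact: indicE_ge0.
Qed.

HB.instance Definition _ := isOuterMeasure.Build R T counting_outer
  counting_outer0 counting_outer_ge0 counting_outer_le
  counting_outer_sigma_subadditive.

Lemma counting_outer_caratheodory (A : set T) : counting_outer.-caratheodory A.
Proof.
move=> B; rewrite /counting_outer -big_split/=; apply: eq_bigr => i _.
rewrite -EFinD !indicE !in_setI in_setC -natrD; congr (_%:R%:E).
by case: (i \in A); case: (i \in B).
Qed.

Lemma counting_outerT : counting_outer setT = (#|T|%:R)%:E.
Proof.
rewrite /counting_outer sumEFin; congr EFin.
by under eq_bigr do rewrite indicT; rewrite sumr_const.
Qed.

Lemma counting_outer_ge1 (A : set T) x : A x -> (1 <= counting_outer A)%E.
Proof.
move=> Ax; rewrite /counting_outer (bigD1 x)//= indicE mem_set// leeDl//.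
by apply: sume_ge0 => i _; exact: indicE_ge0.
Qed.

End counting_outer_measure.

Section complete_graph_doubling.
Context {R : realType} {n : nat}.
Local Notation K := (graph_space R (complete_graph n)).

Lemma gdist_complete_le1 (x y : vertex (complete_graph n)) :
  (gdist x y <= 1)%N.
Proof.
have [->|xy] := eqVneq x y; first by rewrite gdistxx.
by apply: gdist_le; exists [:: y]; split => //=; rewrite andbT.
Qed.

Lemma ball_complete1 (x : K) : ball x (1 : R) = [set x].
Proof.
apply/seteqP; split => y; rewrite ballEmdist /= mdist_graphE.
  by rewrite ltrn1 ltnS leqn0 => /eqP/gdist_eq0.
by move=> ->; rewrite gdistxx ltr01.
Qed.

Lemma ball_complete2 (x : K) : ball x (2 : R) = setT.
Proof.
apply/seteqP; split => // y _; rewrite ballEmdist /= mdist_graphE.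
by rewrite ltr_nat ltnS gdist_complete_le1.
Qed.

(** Unit balls are singletons, so the topology is discrete. Hence every set is Borel, which both
    inequalities below rely on. *)
Lemma open_complete (A : set K) : open A.
Proof.
rewrite openE => x Ax; apply/nbhs_ballP; exists 1 => //=.
by rewrite ball_complete1 => y ->.
Qed.

(** The carrier of [K] unfolds to ['I_n], so the counting measure is transported by conversion. *)
Let count : {outer_measure set K -> \bar R} := @counting_outer R 'I_n.

Let count_le A : (count A <= n%:R%:E)%E.
Proof.
by rewrite -[X in X%:R%:E]card_ord -counting_outerT; exact: le_outer_measure.
Qed.

Let count_ball_ge1 (x : K) (r : R) : 0 < r -> (1 <= count (ball x r))%E.
Proof.
by move=> r0; apply: (@counting_outer_ge1 R 'I_n _ x); exact: ballxx.
Qed.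

(** No case analysis on [r]: the larger ball counts at most [n] points and the smaller one at least
    1. *)
Let count_doubling (x : K) (r : R) : 0 < r ->
  (count (ball x (2 * r)) <= n%:R%:E * count (ball x r))%E.
Proof.
move=> r0; apply: (le_trans (count_le _)).
by rewrite -[leLHS]mule1 lee_wpmul2l ?lee_fin// count_ball_ge1.
Qed.

Lemma least_doubling_const_complete_le : (0 < n)%N ->
  (least_doubling_const K <= n%:R%:E)%E.
Proof.
move=> n0; apply: (@le_trans _ _ (doubling_const count)).
  apply: ereal_inf_lbound; exists count => //; split.
  - split=> [A _|A]; first exact: counting_outer_caratheodory.
    by exists A; split => //; apply: sub_sigma_algebra; exact: open_complete.
  - move=> x r r0; split; first exact: (lt_le_trans lte01 (count_ball_ge1 x r r0)).
    exact: (le_lt_trans (count_le _) (ltry _)).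
  - by exists n%:R; rewrite ler1n.
apply: ge_ereal_sup => _ [x [r [r0 ->]]].
have := count_doubling x r r0; have := count_ball_ge1 x r r0.
(* The two bounds on the count rule out both infinite values, so the quotient is an ordinary
   division by a real [m >= 1]. *)
have := count_le (ball x r); case: (count (ball x r)) => // m _ m1.
have m0 : 0 < m by apply: lt_le_trans ltr01 _; rewrite -lee_fin.
by rewrite inver gt_eqF// lee_pdivrMr.
Qed.

Lemma least_doubling_const_complete_ge : (0 < n)%N ->
  (n%:R%:E <= least_doubling_const K)%E.
Proof.
move=> n0; apply: le_ereal_inf_tmp => _ [mu [[mu_cara _] mu_fin _] <-].
pose f (i : 'I_n) := fine (mu [set (i : K)]).
have fE i : mu [set (i : K)] = (f i)%:E.
  rewrite fineK// fin_numElt; have [] := mu_fin i 1 ltr01.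
  by rewrite ball_complete1 => + ->; rewrite andbT; apply: lt_trans; exact: ltNyr.
have [x _ xmin] := arg_minP f (erefl : xpredT (Ordinal n0)).
have f0 : 0 < f x.
  by rewrite -lte_fin -fE -ball_complete1; have [] := mu_fin x 1 ltr01.
(* This is the ratio at centre [x] and radius 1. *)
apply: (@le_trans _ _ (mu setT / mu [set (x : K)])%E); last first.
  apply: ereal_sup_ubound; exists x, 1.
  by rewrite mulr1 ball_complete1 ball_complete2.
rewrite fE inver gt_eqF// lee_pdivlMr//.
have mu1 (y : K) : mu.-caratheodory [set y].
  by apply: mu_cara; apply: sub_sigma_algebra; exact: open_complete.
(* What remains is [n * f x <= mu setT]: the masses of all vertices sum to at most [mu setT], and
   each is at least [f x]. *)
have := @sum_caratheodory_set1_le R K mu (enum 'I_n) mu1 (enum_uniq _).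
move=> /le_trans/(_ (le_outer_measure mu _ setT (@subsetT _ _))).
apply: le_trans.
rewrite (eq_bigr (fun i => (f i)%:E)) => [|i _]; last exact: fE.
rewrite sumEFin -EFinM lee_fin big_enum/= mulr_natl -[X in _ *+ X]card_ord.
by rewrite -sumr_const; apply: ler_sum => i _; exact: xmin.
Qed.

End complete_graph_doubling.

Theorem proposition5p2 (R : realType) (n : nat) (hn : (2 <= n)%N) :
  graph_doubling_const R (complete_graph n) = (n%:R)%:E.
Proof.
have n0 : (0 < n)%N by exact: ltnW.
apply/eqP; rewrite eq_le; apply/andP; split.
  exact: least_doubling_const_complete_le.
exact: least_doubling_const_complete_ge.
Qed.
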